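(* Let $\mathcal C$ be a class of convergence spaces that contains either: (1) every finite GL frame, or (2) every finite TC frame, or (3) every ordinal space $\Lambda$ with $\Lambda<\omega^\omega$, or (4) some crowded metric space (with its limit operator). Then there exist formulas $\theta\in\mathcal L^{\mu}_{{\Diamond}}$ of arbitrarily large size such that, whenever $\psi\in\mathcal L^{{\Diamond}^\ast}_{{\Diamond}\forall}$ is equivalent to $\theta$ over $\mathcal C$, it follows that $|\psi|>2^{|\theta|/12}$.
   Context: Formulas are in negation normal form over a countably infinite set $P$ of propositional variables: built from $\top,\bot$, literals $p,\overline p$ ($\overline p$ the negation of $p$), with $\wedge,\vee$, modalities ${\Diamond},{\Box}$, and in extended languages $\forall,\exists$, tangled modalities ${\Diamond}^\ast\{\varphi_1,\dots,\varphi_k\}$, ${\Box}^\ast\{\varphi_1,\dots,\varphi_k\}$, and fixed point operators $\mu p.\varphi$, $\nu p.\varphi$ (allowed only when $\overline p$ does not occur in $\varphi$). $\neg\varphi$ abbreviates the De Morgan dual. $\mathcal L^\mu_{\Diamond}$ allows $\top,\bot$, literals, $\wedge,\vee,{\Diamond},{\Box},\mu,\nu$; $\mathcal L^{{\Diamond}^\ast}_{{\Diamond}\forall}$ allows $\top,\bot$, literals, $\wedge,\vee,{\Diamond},{\Box},\forall,\exists,{\Diamond}^\ast,{\Box}^\ast$. The size $|\varphi|$ is the number of nodes of the syntax tree: constants and literals have size 1, binary connectives add 1 to the sum of sizes, unary operators (including $\mu p$, $\nu p$) add 1, and $|{\Diamond}^\ast\{\varphi_1,\dots,\varphi_k\}|=|{\Box}^\ast\{\dots\}|=|\varphi_1|+\dots+|\varphi_k|+1$.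 A convergence space is a pair $(X,\rho)$ with $\rho\colon 2^X\to2^X$ satisfying $\rho(\varnothing)=\varnothing$, $\rho(A\cup B)=\rho(A)\cup\rho(B)$, $\rho(\rho(A))\subseteq\rho(A)$; a model adds a valuation $V\colon X\to 2^P$. Truth sets: $[\![p]\!]=\{x:p\in V(x)\}$, $[\![\overline p]\!]$ its complement, $\wedge,\vee$ as $\cap,\cup$, $[\![{\Diamond}\varphi]\!]=\rho([\![\varphi]\!])$, $[\![{\Box}\varphi]\!]=X\setminus\rho(X\setminus[\![\varphi]\!])$, $[\![\forall\varphi]\!]=X$ if $[\![\varphi]\!]=X$ else $\varnothing$, $[\![\exists\varphi]\!]=X$ if $[\![\varphi]\!]\ne\varnothing$ else $\varnothing$; $x\in[\![{\Diamond}^\ast\{\varphi_1,\dots,\varphi_k\}]\!]$ iff there is $S\ni x$ with $S\subseteq\rho(S\cap[\![\varphi_i]\!])$ for all $i$, and ${\Box}^\ast\{\varphi_1,\dots,\varphi_k\}$ holds exactly where ${\Diamond}^\ast\{\neg\varphi_1,\dots,\neg\varphi_k\}$ fails; $[\![\mu p.\varphi]\!]$ and $[\![\nu p.\varphi]\!]$ are the least and greatest fixed points of the monotone map $Y\mapsto[\![\varphi]\!]$ computed with $p$ reinterpreted as true exactly on $Y$. Two formulas are equivalent over a class of convergence spaces if they have the same truth set in every model on every space of the class. A Kripke frame $(W,R)$ with $R$ transitive is regarded as the convergence space with $\rho(A)=\{w:\exists v\in A,\ wRv\}$. A finite GL frame is a finite Kripke frame with $R$ transitive and irreflexive. A TC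 frame is a Kripke frame with $R$ transitive and serial, connected (any two points are joined by a finite sequence each consecutive pair of which is related by $R$ in one direction or the other) and locally connected (for each $a$, any two points of $R(a)$ are joined by such a sequence inside $R(a)$). A metric space is regarded as a convergence space via its limit operator ($x\in d(A)$ iff every ball around $x$ contains a point of $A$ other than $x$); crowded means no isolated points. An ordinal $\Lambda$ is the convergence space with $\xi\in d(A)$ iff $A\cap\xi$ is unbounded in $\xi$. *)

(* Defs.v *)
From Stdlib Require List.
From HB Require Import structures.
From mathcomp Require Import all_boot all_order all_algebra.
From mathcomp Require Import all_classical all_reals all_analysis.

Set Implicit Arguments.
Unset Strict Implicit.
Unset Printing Implicit Defensive.

Import Order.TTheory GRing.Theory Num.Theory.
Local Open Scope classical_set_scope.

(* Propositional variables are natural numbers.  The finite sets under the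
   tangled modalities are lists: a repetition does not change the truth set and
   only increases the size, and the empty list gives a formula of size 1 that is
   equivalent to [Top] under [DiaT] and to [Bot] under [BoxT]. *)
Inductive formula : Type :=
| Top
| Bot
| Var (p : nat)
| NVar (p : nat)
| And (f g : formula)
| Or (f g : formula)
| Dia (f : formula)
| Box (f : formula)
| All (f : formula)
| Ex (f : formula)
| DiaT (fs : seq formula)
| BoxT (fs : seq formula)
| Mu (p : nat) (f : formula)
| Nu (p : nat) (f : formula).

Fixpoint fsize (f : formula) : nat :=
  match f with
  | Top | Bot | Var _ | NVar _ => 1
  | And f g | Or f g => (fsize f + fsize g).+1
  | Dia f | Box f | All f | Ex f | Mu _ f | Nu _ f => (fsize f).+1
  | DiaT fs | BoxT fs => (sumn (map fsize fs)).+1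
  end.

(* The literal occurs even when it stands below a fixed point binder for [p]. *)
Fixpoint neg_occurs (p : nat) (f : formula) : bool :=
  match f with
  | Top | Bot | Var _ => false
  | NVar q => q == p
  | And f g | Or f g => neg_occurs p f || neg_occurs p g
  | Dia f | Box f | All f | Ex f | Mu _ f | Nu _ f => neg_occurs p f
  | DiaT fs | BoxT fs => has (neg_occurs p) fs
  end.

Fixpoint in_Lmu (f : formula) : bool :=
  match f with
  | Top | Bot | Var _ | NVar _ => true
  | And f g | Or f g => in_Lmu f && in_Lmu g
  | Dia f | Box f => in_Lmu f
  | Mu p f | Nu p f => ~~ neg_occurs p f && in_Lmu f
  | All _ | Ex _ | DiaT _ | BoxT _ => false
  end.

Fixpoint in_Ltangle_forall (f : formula) : bool :=
  match f with
  | Top | Bot | Var _ | NVar _ => true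
  | And f g | Or f g => in_Ltangle_forall f && in_Ltangle_forall g
  | Dia f | Box f | All f | Ex f => in_Ltangle_forall f
  | DiaT fs | BoxT fs => all in_Ltangle_forall fs
  | Mu _ _ | Nu _ _ => false
  end.

Record convergence_space : Type := ConvergenceSpace {
  cs_point :> Type;
  rho : set cs_point -> set cs_point;
  rho0 : rho set0 = set0;
  rhoU : forall A B, rho (A `|` B) = rho A `|` rho B;
  rho_rho : forall A, rho (rho A) `<=` rho A
}.

Arguments rho {_} _.

(* Knaster-Tarski form; see [truth_Mu] and [truth_Nu] below. *)
Definition lfp {T : Type} (F : set T -> set T) : set T :=
  \bigcap_(Y in [set Y | F Y `<=` Y]) Y.

Definition gfp {T : Type} (F : set T -> set T) : set T :=
  \bigcup_(Y in [set Y | Y `<=` F Y]) Y.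

Section semantics.
Variable X : convergence_space.

Definition tangle (As : seq (set X)) : set X :=
  [set x | exists2 S : set X, S x & forall A, A \in As -> S `<=` rho (S `&` A)].

Definition update (V : X -> set nat) (p : nat) (Y : set X) : X -> set nat :=
  fun x => [set q | if q == p then Y x else V x q].

(* In the clause for [BoxT], the truth set of the De Morgan dual of a formula
   is the complement of its truth set. *)
Fixpoint truth (V : X -> set nat) (f : formula) : set X :=
  match f with
  | Top => setT
  | Bot => set0
  | Var p => [set x | V x p]
  | NVar p => ~` [set x | V x p]
  | And f g => truth V f `&` truth V g
  | Or f g => truth V f `|` truth V g
  | Dia f => rho (truth V f)
  | Box f => ~` rho (~` truth V f)
  | All f => if `[< truth V f = setT >] then setT else set0
  | Ex f => if `[< truth V f <> set0 >] then setT else set0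
  | DiaT fs => tangle (map (truth V) fs)
  | BoxT fs => ~` tangle (map (fun f => ~` truth V f) fs)
  | Mu p f => lfp (fun Y => truth (update V p Y) f)
  | Nu p f => gfp (fun Y => truth (update V p Y) f)
  end.

End semantics.

Definition equivalent (C : convergence_space -> Prop) (f g : formula) : Prop :=
  forall X : convergence_space, C X ->
  forall V : X -> set nat, truth V f = truth V g.

Section kripke.
Variables (W : Type) (r : rel W).
Hypothesis r_trans : transitive r.

Definition kripke_rho (A : set W) : set W := [set w | exists2 v, A v & r w v].

Lemma kripke_rho0 : kripke_rho set0 = set0.
Proof. by apply/seteqP; split => x // [v []]. Qed.

Lemma kripke_rhoU A B :
  kripke_rho (A `|` B) = kripke_rho A `|` kripke_rho B.
Proof.
apply/seteqP; split => x; first by case=> v [Av|Bv] xv; [left|right]; exists v.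
by case=> -[v vP xv]; exists v => //; [left|right].
Qed.

Lemma kripke_rho_rho A : kripke_rho (kripke_rho A) `<=` kripke_rho A.
Proof. by move=> x [v [u Au vu] xv]; exists u => //; exact: r_trans vu. Qed.

Definition kripke_space : convergence_space :=
  ConvergenceSpace kripke_rho0 kripke_rhoU kripke_rho_rho.

End kripke.

Definition serial (W : Type) (r : rel W) : Prop := forall a, exists b, r a b.

Definition connected_frame (W : finType) (r : rel W) : Prop :=
  forall a b, connect [rel u v | r u v || r v u] a b.

Definition locally_connected_frame (W : finType) (r : rel W) : Prop :=
  forall a b c, r a b -> r a c ->
  connect [rel u v | [&& r a u, r a v & r u v || r v u]] b c.

Section metric.
Variables (R : realType) (X : metricType R).

Lemma limit_point0 : limit_point (set0 : set X) = set0.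
Proof. by apply/seteqP; split => x // /(_ setT filterT)[y []]. Qed.

Lemma limit_pointU (A B : set X) :
  limit_point (A `|` B) = limit_point A `|` limit_point B.
Proof.
apply/seteqP; split => x; last first.
  by case=> xP U /xP [y [yx yA Uy]]; exists y; split => //; [left|right].
move=> xAB; apply: contrapT => /not_orP[].
move=> /existsNP[U /not_implyP[xU UA]] /existsNP[V /not_implyP[xV VB]].
have [y [yx [Ay|By] [Uy Vy]]] := xAB (U `&` V) (filterI xU xV).
- by apply: UA; exists y.
- by apply: VB; exists y.
Qed.

Lemma limit_point_limit_point (A : set X) :
  limit_point (limit_point A) `<=` limit_point A.
Proof.
move=> x xA U; rewrite nbhsE => -[V [oV Vx] VU].
have [y [yx yA Vy]] := xA V (open_nbhs_nbhs (conj oV Vx)).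
have yx' : nbhs y (~` [set x]).
  apply: open_nbhs_nbhs; split; last by apply/eqP.
  apply: closed_openC; apply: accessible_closed_set1.
  apply: hausdorff_accessible; exact: metric_hausdorff.
have [z [_ Az [Vz zx]]] :=
  yA (V `&` ~` [set x]) (filterI (open_nbhs_nbhs (conj oV Vy)) yx').
by exists z; split => //; [apply/eqP|exact: VU].
Qed.

Definition metric_space : convergence_space :=
  ConvergenceSpace limit_point0 limit_pointU limit_point_limit_point.

End metric.

Definition crowded (T : topologicalType) : Prop := isolated [set: T] = set0.

Section ordinals.
Local Open Scope ring_scope.

(* Cantor normal form: a polynomial [x] with natural coefficients stands for
   the ordinal [omega^n * x`_n + ... + omega * x`_1 + x`_0]. *)
Definition ordinal_ww : Type := {poly nat}.

Definition olt (x y : ordinal_ww) : Prop :=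
  exists2 i, ((x`_i)%R < (y`_i)%R)%N & forall j, (i < j)%N -> x`_j = y`_j.

Lemma olt_irr x : ~ olt x x.
Proof. by case=> i; rewrite ltnn. Qed.

Lemma olt_trans y x z : olt x y -> olt y z -> olt x z.
Proof.
move=> [i xy xyE] [j yz yzE]; case: (ltngtP i j) => ij.
- exists j; first by rewrite xyE.
  by move=> k jk; rewrite xyE ?yzE//; exact: ltn_trans jk.
- exists i; first by rewrite -yzE.
  by move=> k ik; rewrite xyE ?yzE//; exact: ltn_trans ik.
- rewrite -{j}ij in yz yzE; exists i; first exact: ltn_trans yz.
  by move=> k ik; rewrite xyE ?yzE.
Qed.

Lemma olt_total x y : [\/ olt x y, x = y | olt y x].
Proof.
have [n xn yn] : exists2 n, (size x <= n)%N & (size y <= n)%N.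
  by exists (maxn (size x) (size y)); rewrite ?leq_maxl ?leq_maxr.
pose P i := x`_i != y`_i.
have Pn i : P i -> (i <= n)%N.
  by rewrite leqNgt; apply: contra => ni; rewrite !nth_default//;
    apply: leq_trans (ltnW ni).
case: (pselect (exists i, P i)) => [exP|noP]; last first.
  constructor 2; apply/polyP => i; apply/eqP/negPn/negP => iP.
  by apply: noP; exists i.
case: (ex_maxnP exP Pn) => i xyi imax.
have eqi j : (i < j)%N -> x`_j = y`_j.
  by move=> ij; apply/eqP/negPn/negP => /imax; rewrite leqNgt ij.
case: (ltngtP (x`_i)%R (y`_i)%R) => [lt_xy|lt_yx|eq_xy].
- by constructor 1; exists i.
- by constructor 3; exists i => // j /eqi.
- by move: xyi; rewrite /P eq_xy eqxx.
Qed.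

End ordinals.

Section ordinal_space.
Variable Lambda : ordinal_ww.

Definition ordinal_point : Type := {xi : ordinal_ww | olt xi Lambda}.

(* The condition on 0 is explicit because the empty set is vacuously unbounded
   in 0. *)
Definition ordinal_rho (A : set ordinal_point) : set ordinal_point :=
  [set xi | sval xi <> 0%R /\
    forall zeta : ordinal_ww, olt zeta (sval xi) ->
    exists eta, [/\ A eta, olt zeta (sval eta) & olt (sval eta) (sval xi)]].

Lemma olt0 (x : ordinal_ww) : x <> 0%R -> olt 0%R x.
Proof.
move=> x0; case: (olt_total 0%R x) => [//|x0'|[i]]; first by case: x0.
by rewrite coef0.
Qed.

Lemma ordinal_rho0 : ordinal_rho set0 = set0.
Proof. by apply/seteqP; split => x // [/olt0 x0 /(_ _ x0)[eta []]]. Qed.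

Lemma ordinal_rhoU A B :
  ordinal_rho (A `|` B) = ordinal_rho A `|` ordinal_rho B.
Proof.
apply/seteqP; split => x; last first.
  by case=> -[x0 xP]; split => // z /xP[e [Ae ze ex]]; exists e; split => //;
    [left|right].
move=> [x0 xAB]; apply: contrapT => /not_orP[].
move=> /not_andP[//|/existsNP[z /not_implyP[zx zA]]].
move=> /not_andP[//|/existsNP[t /not_implyP[tx tB]]].
have [u [ux zu tu]] : exists u, [/\ olt u (sval x),
    forall e, olt u e -> olt z e & forall e, olt u e -> olt t e].
  case: (olt_total z t) => [zt|<-|tz].
  - by exists t; split => // e; exact: olt_trans.
  - by exists z.
  - by exists z; split => // e; exact: olt_trans.
have [e [[Ae|Be] ue ex]] := xAB _ ux.
- by apply: zA; exists e; split => //; exact: zu.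
- by apply: tB; exists e; split => //; exact: tu.
Qed.

Lemma ordinal_rho_rho A : ordinal_rho (ordinal_rho A) `<=` ordinal_rho A.
Proof.
move=> x [x0 xP]; split=> // z /xP[y [[_ yP] zy yx]].
have [e [Ae ze ey]] := yP _ zy.
by exists e; split => //; exact: olt_trans yx.
Qed.

Definition ordinal_space : convergence_space :=
  ConvergenceSpace ordinal_rho0 ordinal_rhoU ordinal_rho_rho.

End ordinal_space.

Section fixed_points.
Variables (T : Type) (F : set T -> set T).
Hypothesis F_mono : forall Y Z, Y `<=` Z -> F Y `<=` F Z.

Lemma lfp_least Y : F Y `<=` Y -> lfp F `<=` Y.
Proof. by move=> FY x; apply. Qed.

Lemma lfp_fixed : F (lfp F) = lfp F.
Proof.
have sub : F (lfp F) `<=` lfp F.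
  by move=> x Fx Y FY; apply: (FY); apply: F_mono Fx; exact: lfp_least.
by apply/seteqP; split => //; apply: lfp_least; exact: F_mono.
Qed.

Lemma gfp_greatest Y : Y `<=` F Y -> Y `<=` gfp F.
Proof. by move=> FY x Yx; exists Y. Qed.

Lemma gfp_fixed : F (gfp F) = gfp F.
Proof.
have sub : gfp F `<=` F (gfp F).
  by move=> x [Y FY /FY]; apply: F_mono; exact: gfp_greatest.
by apply/seteqP; split => //; apply: gfp_greatest; exact: F_mono.
Qed.

End fixed_points.

Section formula_induction.
Variable P : formula -> Prop.
Hypotheses (PTop : P Top) (PBot : P Bot) (PVar : forall p, P (Var p))
  (PNVar : forall p, P (NVar p))
  (PAnd : forall f g, P f -> P g -> P (And f g))
  (POr : forall f g, P f -> P g -> P (Or f g))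
  (PDia : forall f, P f -> P (Dia f)) (PBox : forall f, P f -> P (Box f))
  (PAll : forall f, P f -> P (All f)) (PEx : forall f, P f -> P (Ex f))
  (PDiaT : forall fs, List.Forall P fs -> P (DiaT fs))
  (PBoxT : forall fs, List.Forall P fs -> P (BoxT fs))
  (PMu : forall p f, P f -> P (Mu p f)) (PNu : forall p f, P f -> P (Nu p f)).

Fixpoint formula_nested_ind (f : formula) : P f :=
  let fix list_ind (fs : seq formula) : List.Forall P fs :=
    match fs with
    | [::] => List.Forall_nil P
    | f :: fs => List.Forall_cons f (formula_nested_ind f) (list_ind fs)
    end in
  match f with
  | Top => PTop
  | Bot => PBot
  | Var p => PVar p
  | NVar p => PNVar p
  | And f g => PAnd (formula_nested_ind f) (formula_nested_ind g)
  | Or f g => POr (formula_nested_ind f) (formula_nested_ind g)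
  | Dia f => PDia (formula_nested_ind f)
  | Box f => PBox (formula_nested_ind f)
  | All f => PAll (formula_nested_ind f)
  | Ex f => PEx (formula_nested_ind f)
  | DiaT fs => PDiaT (list_ind fs)
  | BoxT fs => PBoxT (list_ind fs)
  | Mu p f => PMu p (formula_nested_ind f)
  | Nu p f => PNu p (formula_nested_ind f)
  end.

End formula_induction.

Section truth_monotone.
Variable X : convergence_space.

Lemma rho_mono (A B : set X) : A `<=` B -> rho A `<=` rho B.
Proof. by move=> AB x Ax; rewrite -(setUidr AB) rhoU; left. Qed.

(* [S] contains all the variables on which [V] is smaller than [V']. *)
Lemma truth_le (f : formula) (S : set nat) (V V' : X -> set nat) :
  (forall q, S q -> ~~ neg_occurs q f) ->
  (forall x q, V x q -> V' x q) ->
  (forall x q, ~ S q -> V' x q -> V x q) ->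
  truth V f `<=` truth V' f.
Proof.
elim/formula_nested_ind: f S V V' => /=
  [||p|p|f g IHf IHg|f g IHf IHg|f IHf|f IHf|f IHf|f IHf|fs IHfs|fs IHfs
  |p f IHf|p f IHf] S V V' nS VV' V'V.
- by [].
- by [].
- by move=> x; exact: VV'.
- move=> x /= NVx V'x; apply: NVx; apply: V'V => //.
  by move=> /nS; rewrite eqxx.
- have [nf ng] : (forall q, S q -> ~~ neg_occurs q f) /\
      (forall q, S q -> ~~ neg_occurs q g).
    by split => q /nS; rewrite negb_or => /andP[].
  by apply: setISS; [exact: IHf nf VV' V'V|exact: IHg ng VV' V'V].
- have [nf ng] : (forall q, S q -> ~~ neg_occurs q f) /\
      (forall q, S q -> ~~ neg_occurs q g).
    by split => q /nS; rewrite negb_or => /andP[].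
  by apply: setUSS; [exact: IHf nf VV' V'V|exact: IHg ng VV' V'V].
- by apply: rho_mono; exact: IHf nS VV' V'V.
- by apply: subsetC; apply: rho_mono; apply: subsetC; exact: IHf nS VV' V'V.
- case: (asboolP (truth V f = setT)) => fT; last exact: sub0set.
  case: (asboolP (truth V' f = setT)) => [//|nfT]; exfalso; apply: nfT.
  by apply/seteqP; split => // x _; apply: (IHf _ _ _ nS VV' V'V); rewrite fT.
- case: (asboolP (truth V f <> set0)) => f0; last exact: sub0set.
  case: (asboolP (truth V' f <> set0)) => [//|nf0]; exfalso; apply: f0.
  have f0' : truth V' f = set0 by exact: contrapT.
  by apply/seteqP; split => // x /(IHf _ _ _ nS VV' V'V); rewrite f0'.
- move=> x [Y Yx YP]; exists Y => // A /(nthP set0)[i].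
  rewrite size_map => ilt <-; rewrite (nth_map Top)//.
  apply: (@subset_trans _ (rho (Y `&` truth V (nth Top fs i)))).
    by apply: YP; rewrite -(nth_map Top set0)// mem_nth ?size_map.
  apply: rho_mono; apply: setIS.
  have fsi : List.In (nth Top fs i) fs.
    elim: fs i ilt {IHfs nS YP} => [//|g fs IH] [|i] /= ilt; first by left.
    by right; exact: IH.
  move/List.Forall_forall: IHfs => /(_ _ fsi) IH.
  apply: IH VV' V'V => q /nS; apply: contra => qf; apply/(has_nthP Top).
  by exists i.
- apply: subsetC => x [Y Yx YP]; exists Y => // A /(nthP set0)[i].
  rewrite size_map => ilt <-; rewrite (nth_map Top)//.
  apply: (@subset_trans _ (rho (Y `&` ~` truth V' (nth Top fs i)))).
    apply: YP; rewrite -(nth_map Top set0 (fun f => ~` truth V' f))//.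
    by rewrite mem_nth ?size_map.
  apply: rho_mono; apply: setIS; apply: subsetC.
  have fsi : List.In (nth Top fs i) fs.
    elim: fs i ilt {IHfs nS YP} => [//|g fs IH] [|i] /= ilt; first by left.
    by right; exact: IH.
  move/List.Forall_forall: IHfs => /(_ _ fsi) IH.
  apply: IH VV' V'V => q /nS; apply: contra => qf; apply/(has_nthP Top).
  by exists i.
- move=> x xP Y FY; apply: xP; apply: subset_trans FY.
  apply: (IHf S) => // y q; rewrite /update/=; case: eqP => // _.
  + exact: VV'.
  + exact: V'V.
- move=> x [Y FY Yx]; exists Y => //; apply: (subset_trans FY).
  apply: (IHf S) => // y q; rewrite /update/=; case: eqP => // _.
  + exact: VV'.
  + exact: V'V.
Qed.

Lemma truth_update_mono (V : X -> set nat) p f (Y Z : set X) :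
  ~~ neg_occurs p f -> Y `<=` Z ->
  truth (update V p Y) f `<=` truth (update V p Z) f.
Proof.
move=> npf YZ; apply: (@truth_le f [set p]) => /=.
- by move=> _ ->.
- by move=> x q; rewrite /update/=; case: eqP => // _; exact: YZ.
- by move=> x q qp; rewrite /update/=; case: eqP.
Qed.

Lemma truth_Mu (V : X -> set nat) p f (F := fun Y => truth (update V p Y) f) :
  ~~ neg_occurs p f ->
  F (truth V (Mu p f)) = truth V (Mu p f) /\
  forall Y, F Y = Y -> truth V (Mu p f) `<=` Y.
Proof.
move=> npf; split; first by apply: lfp_fixed => Y Z; exact: truth_update_mono.
by move=> Y FY; apply: lfp_least => x; rewrite -{2}FY.
Qed.

Lemma truth_Nu (V : X -> set nat) p f (F := fun Y => truth (update V p Y) f) :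
  ~~ neg_occurs p f ->
  F (truth V (Nu p f)) = truth V (Nu p f) /\
  forall Y, F Y = Y -> Y `<=` truth V (Nu p f).
Proof.
move=> npf; split; first by apply: gfp_fixed => Y Z; exact: truth_update_mono.
by move=> Y FY; apply: gfp_greatest => x; rewrite -{1}FY.
Qed.

End truth_monotone.

(* Main.v *)
(* The formula [theta n] is [theta 0 = p_0], [theta n = dia_refl (p_n /\ box_refl
   (q_n \/ theta n.-1))] for the reflexive closures
   [dia_refl f = mu x. f \/ Dia x] and [box_refl f = nu x. f /\ Box x], so that
   it has size 12 n + 1.  For every word [s] of length [n] over the two
   modalities there are two trees, one satisfying [theta n] and the other not,
   such that at each layer only the next modality of [s], and no other one, can
   make progress in telling them apart: at a [Dia] layer every successor on the
   second side is also one on the first side, at a [Box] layer it is the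
   converse.  Hence any separating formula has a branch whose sequence of
   modalities is [s], so any formula equivalent to [theta n] has at least [2^n]
   branches.  The modalities [All], [Ex] and the tangled ones do not help,
   because their truth sets are constant in the models used.

   Each such tree is a quotient of a model based on a space in the class.  When
   dead ends are impossible (TC frames, crowded metric spaces), a point at
   infinity that is seen by everything is added to the tree; in a crowded metric
   space it is the image of the complement of a closed scattered set. *)

Require Import Defs.
From HB Require Import structures.
From mathcomp Require Import all_boot all_order all_algebra.
From mathcomp Require Import all_classical all_reals all_analysis.
From mathcomp Require Import lra zify.

Set Implicit Arguments.
Unset Strict Implicit.
Unset Printing Implicit Defensive.

Import Order.TTheory GRing.Theory Num.Theory.
Local Open Scope classical_set_scope.
Local Open Scope ring_scope.

(** * Modal paths of a formula *)

(* [All], [Ex] and the tangled modalities get no path: their truth sets are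
   constant in the models used below. *)
Fixpoint modal_paths (f : formula) : seq (seq bool) :=
  match f with
  | Top | Bot | Var _ | NVar _ => [:: [::]]
  | And f g | Or f g => modal_paths f ++ modal_paths g
  | Dia f => map (cons true) (modal_paths f)
  | Box f => map (cons false) (modal_paths f)
  | _ => [::]
  end.

(* The summand [has _ _] accounts for a modality, which costs one extra node. *)
Lemma size_modal_paths f :
  (2 * size (modal_paths f) + has (predC1 [::]) (modal_paths f) <= (fsize f).+1)%N.
Proof.
elim: f => //= [f IHf g IHg|f IHf g IHg|f IHf|f IHf].
- rewrite has_cat size_cat; move: IHf IHg.
  by case: (has _ _) (has _ _) => -[]; lia.
- rewrite has_cat size_cat; move: IHf IHg.
  by case: (has _ _) (has _ _) => -[]; lia.
- by rewrite size_map; move: IHf; case: (has _ _) (has _ _) => -[]; lia.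
- by rewrite size_map; move: IHf; case: (has _ _) (has _ _) => -[]; lia.
Qed.

(** Distinct words are distinct branches, each worth two nodes. The words are nonempty, so [f] has a
    modality, and its extra node cancels the successor in [size_modal_paths]. *)
Lemma fsize_all_paths n f :
  (forall s, size s = n.+1 -> s \in modal_paths f) -> (2 ^ n.+2 <= fsize f)%N.
Proof.
move=> sf; have hasf : has (predC1 [::]) (modal_paths f).
  apply/hasP; exists (nseq n.+1 true); last by [].
  by apply: sf; rewrite size_nseq.
have := size_modal_paths f; rewrite hasf addn1 ltnS; apply: leq_trans.
rewrite expnS leq_mul2l /=.
have -> : (2 ^ n.+1 = size (map val (enum {: n.+1.-tuple bool})))%N.
  by rewrite size_map -cardE card_tuple card_bool.
apply: uniq_leq_size; first by rewrite (map_inj_uniq val_inj) enum_uniq.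
by move=> s /mapP[t _ ->]; apply: sf; rewrite size_tuple.
Qed.

(** * Coloured spaces *)

(** [formula] carries no decidable equality, so membership in [fs] is [List.In], to match the
    [List.Forall] of [formula_nested_ind]. *)
Lemma in_mapP (T : Type) (F : formula -> set T) fs A :
  A \in map F fs -> exists2 g, List.In g fs & A = F g.
Proof.
elim: fs => //= g fs IH; rewrite inE => /orP[/eqP->|/IH[h hfs ->]].
  by exists g => //; left.
by exists h => //; right.
Qed.

Lemma all_In (P : pred formula) fs g : all P fs -> List.In g fs -> P g.
Proof. by elim: fs => //= h fs IH /andP[Ph Pfs] [<-//|]; exact: IH. Qed.


(** * Labelled ternary trees and their proper subtrees *)

Inductive tree : Type :=
| Leaf (l : set nat)
| Node (l : set nat) (t1 t2 t3 : tree).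

Definition label (t : tree) : set nat :=
  match t with Leaf l | Node l _ _ _ => l end.

Definition child (t u : tree) : Prop :=
  if t is Node _ t1 t2 t3 then [\/ u = t1, u = t2 | u = t3] else False.

(** Trees are compared structurally: equal subtrees at different places count as one descendant. *)
Fixpoint desc (t u : tree) : Prop :=
  if t is Node _ t1 t2 t3 then
    child t u \/ [\/ desc t1 u, desc t2 u | desc t3 u]
  else False.

Lemma child_desc t u : child t u -> desc t u.
Proof. by case: t => //= l t1 t2 t3; left. Qed.

Lemma descP t u : desc t u <-> exists2 c, child t c & c = u \/ desc c u.
Proof.
case: t => [l|l t1 t2 t3] /=; first by split => // -[].
split.
- case=> [c|[]d]; first by exists u => //; left.
  + by exists t1; [constructor 1|right].
  + by exists t2; [constructor 2|right].
  + by exists t3; [constructor 3|right].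
- by case=> c [] -> [<-|]; [left; constructor 1|right; constructor 1|
    left; constructor 2|right; constructor 2|
    left; constructor 3|right; constructor 3].
Qed.

(** Structural induction reaches the children only, so [P] is carried for all descendants along with
    the tree. *)
Lemma desc_ind (P : tree -> Prop) :
  (forall t, (forall u, desc t u -> P u) -> P t) -> forall t, P t.
Proof.
move=> IH; suff H t : P t /\ forall u, desc t u -> P u by move=> t; case: (H t).
elim: t => [l|l t1 [P1 D1] t2 [P2 D2] t3 [P3 D3]].
  by split=> //; apply: IH.
have H u : desc (Node l t1 t2 t3) u -> P u.
  by move=> [[->|->|->]//|[/D1|/D2|/D3]].
by split => //; apply: IH.
Qed.

Lemma desc_trans t u v : desc t u -> desc u v -> desc t v.
Proof.
elim: t => [|l t1 I1 t2 I2 t3 I3] //= [[->|->|->]|[d|d|d]] uv; right.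
- by constructor 1.
- by constructor 2.
- by constructor 3.
- by constructor 1; exact: I1.
- by constructor 2; exact: I2.
- by constructor 3; exact: I3.
Qed.

Lemma desc_irr t : ~ desc t t.
Proof. by elim/desc_ind: t => t IH tt; exact: (IH t). Qed.

(* The colour [None] stands for a point at infinity above all trees; it sees
   itself, and is seen by all colours, exactly when [b] is true. *)
Definition color := option tree.

Definition below (b : bool) (w u : color) : Prop :=
  match w, u with
  | Some t, Some t' => desc t t'
  | _, None => b
  | None, Some _ => False
  end.

Definition color_label (w : color) : set nat :=
  if w is Some t then label t else [set v | odd v].

Definition pre (b : bool) (B : set color) : set color :=
  [set w | exists2 u, B u & below b w u].

(** The analogue of a bounded morphism into the frame of colours ordered by [below b]: preimages
    turn [pre b] into [rho]. *)
Record coloring (b : bool) (X : convergence_space) (f : X -> color) : Prop := {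
  coloring_forth : forall A x, rho A x -> exists2 y, A y & below b (f x) (f y);
  coloring_back : forall x w, below b (f x) w -> rho (f @^-1` [set w]) x }.

Section coloring_theory.
Variables (b : bool) (X : convergence_space) (f : X -> color).
Hypothesis fP : coloring b f.

Let V : X -> set nat := color_label \o f.

Lemma rho_preimage B : rho (f @^-1` B) = f @^-1` (pre b B).
Proof.
apply/seteqP; split => x.
  by move=> /(coloring_forth fP)[y By xy]; exists (f y).
move=> [w Bw /(coloring_back fP)]; apply: rho_mono => y /= fy.
by rewrite fy.
Qed.

Lemma below_surj x w : below b (f x) w -> exists y, f y = w.
Proof.
move=> /(coloring_back fP) xw; apply: contrapT => nw.
have f0 : f @^-1` [set w] = set0.
  by apply/seteqP; split => // y /= fy; apply: nw; exists y.
by move: xw; rewrite f0 rho0.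
Qed.

Definition color_closed (A : set X) := forall x y, f x = f y -> A x -> A y.

Lemma color_closedC A : color_closed A -> color_closed (~` A).
Proof. by move=> cA x y /esym /cA yx nAx /yx. Qed.

Lemma rho_color A x y :
  color_closed A -> A y -> below b (f x) (f y) -> rho A x.
Proof.
move=> cA Ay /(coloring_back fP); apply: rho_mono => z /= /esym fz.
exact: cA fz Ay.
Qed.

Lemma color_closed_rho A : color_closed A -> color_closed (rho A).
Proof.
move=> cA x y fxy /(coloring_forth fP)[z Az]; rewrite fxy.
exact: rho_color.
Qed.

(* A tangled set of witnesses reaches the colour [None], as trees are
   well-founded; and every point sees that colour. *)
Lemma tangle_const (As : seq (set X)) x y :
  (forall A, A \in As -> color_closed A) -> tangle As x -> tangle As y.
Proof.
move=> cAs [S Sx SP]; case: As => [|A0 As] in cAs SP *.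
  by exists setT.
have A0s : A0 \in A0 :: As by rewrite inE eqxx.
have [z Sz fz] : exists2 z, S z & f z = None.
  case fx: (f x) => [t|]; last by exists x.
  elim/desc_ind: t x fx Sx => t IH x fx Sx.
  have [z [Sz _]] := coloring_forth fP (SP _ A0s _ Sx).
  rewrite fx; case fz: (f z) => [u|]; last by exists z.
  by move=> tu; apply: IH tu _ fz Sz.
(* As [z] sees only the colour [None], every [A] meets the fibre of [None], hence contains it; and
   every point sees that fibre. *)
exists (f @^-1` [set None] `|` [set y]) => [|A As_A u _]; first by right.
have [v [_ Av] ] := coloring_forth fP (SP _ As_A _ Sz).
rewrite fz; case fv: (f v) => [//|] bt.
have : rho (f @^-1` [set None]) u.
  by apply: (coloring_back fP); move: bt; case: (f u).
apply: rho_mono => k /= fk; split; first by left.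
by apply: cAs Av; rewrite // fv fk.
Qed.

Lemma color_closed_truth psi :
  in_Ltangle_forall psi -> color_closed (truth V psi).
Proof.
elim/formula_nested_ind: psi =>
  [||p|p|g h IHg IHh|g h IHg IHh|g IHg|g IHg|g IHg|g IHg|fs IHfs|fs IHfs
  |p g _|p g _] //=.
- by move=> _ x y.
- by move=> _ x y fxy; rewrite /mkset /V /= fxy.
- by move=> _ x y fxy; rewrite /mkset /V /= fxy.
- by move=> /andP[/IHg cg /IHh ch] x y xy [/(cg _ _ xy) ? /(ch _ _ xy)].
- by move=> /andP[/IHg cg /IHh ch] x y xy [/(cg _ _ xy)|/(ch _ _ xy)];
    [left|right].
- by move=> /IHg; exact: color_closed_rho.
- by move=> /IHg /color_closedC /color_closed_rho /color_closedC.
- by move=> _ x y _; case: ifP.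
- by move=> _ x y _; case: ifP.
- move=> fsL x y _; apply: tangle_const => A /in_mapP[g gfs ->].
  by move/List.Forall_forall: IHfs => /(_ _ gfs); apply; exact: all_In gfs.
- move=> fsL x y _; apply: contra_not.
  apply: tangle_const => A /in_mapP[g gfs ->]; apply: color_closedC.
  by move/List.Forall_forall: IHfs => /(_ _ gfs); apply; exact: all_In gfs.
Qed.

(* One branch for each outcome of the comparison game on [w] and [u]: the head
   of [s] is the only modality that can separate them ([true] for [Dia]). *)
Fixpoint forced (s : seq bool) (w u : color) : Prop :=
  match s with
  | [::] => forall v, below b w v <-> below b u v
  | true :: s' =>
      [/\ color_label w = color_label u,
          forall v, below b u v -> below b w v
        & exists w' u', [/\ below b u u', forced s' w' u'
            & forall v, below b w v -> v = w' \/ below b u v]]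
  | false :: s' =>
      [/\ color_label w = color_label u,
          forall v, below b w v -> below b u v
        & exists w' u', [/\ below b w w', forced s' w' u'
            & forall v, below b u v -> v = u' \/ below b w v]]
  end.

(** A witness [x'] for [Dia] at [x] is not seen from [y]. This excludes an empty word and the head
    [false], and leaves only the exceptional colour [w']; the game goes on against a point of colour
    [u']. [Box] is dual. *)
Lemma forced_path psi s x y : in_Ltangle_forall psi ->
  forced s (f x) (f y) -> truth V psi x -> ~ truth V psi y ->
  s \in modal_paths psi.
Proof.
elim/formula_nested_ind: psi s x y =>
  [||p|p|g h IHg IHh|g h IHg IHh|g IHg|g IHg|g _|g _|fs _|fs _|p g _|p g _]
  s x y //=.
- move=> _; rewrite /mkset /V /=.
  by case: s => [|[] s] /= => [//|[-> //]|[-> //]].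
- move=> _; rewrite /mkset /V /=.
  by case: s => [|[] s] /= => [//|[-> //]|[-> //]].
- move=> /andP[Lg Lh] sxy [gx hx] /not_andP[ngy|nhy]; rewrite mem_cat.
    by rewrite (IHg s x y).
  by rewrite (IHh s x y) ?orbT.
- move=> /andP[Lg Lh] sxy [gx|hx] /not_orP[ngy nhy]; rewrite mem_cat.
    by rewrite (IHg s x y).
  by rewrite (IHh s x y) ?orbT.
- move=> Lg sxy /(coloring_forth fP)[x' gx' xx'] ny.
  have cg := color_closed_truth Lg.
  have nyx' : ~ below b (f y) (f x') by move=> yx'; apply: ny; exact: rho_color yx'.
  case: s sxy => [|[] s] /=; first by move=> /(_ (f x'))[/(_ xx')].
    move=> [_ _ [w' [u' [yu' su' /(_ _ xx')[x'E|//]]]]].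
    have [y' fy'] := below_surj yu'.
    rewrite mem_map; last by move=> ? ? [].
    apply: (IHg _ x' y') => //; first by rewrite x'E fy'.
    by move=> gy'; apply: ny; apply: (rho_color cg gy'); rewrite fy'.
  by move=> [_ /(_ _ xx')].
- move=> Lg sxy nx /contrapT/(coloring_forth fP)[y' gy' yy'].
  have cg := color_closedC (color_closed_truth Lg).
  have nxy' : ~ below b (f x) (f y') by move=> xy'; apply: nx; exact: rho_color xy'.
  case: s sxy => [|[] s] /=; first by move=> /(_ (f y'))[_ /(_ yy')].
    by move=> [_ /(_ _ yy')].
  move=> [_ _ [w' [u' [xw' sw' /(_ _ yy')[y'E|//]]]]].
  have [x' fx'] := below_surj xw'.
  rewrite mem_map; last by move=> ? ? [].
  apply: (IHg _ x' y') => //; first by rewrite y'E fx'.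
  apply: contrapT => gx'; apply: nx; apply: (rho_color cg gx').
  by rewrite fx'.
- by move=> _ _; case: ifP.
- by move=> _ _; case: ifP.
- move=> fsL _ tx nty; exfalso; apply: nty; move: tx.
  apply: tangle_const => A /in_mapP[g gfs ->].
  by apply: color_closed_truth; exact: all_In gfs.
- move=> fsL _ tx nty; exfalso; apply: tx; move: nty => /contrapT.
  apply: tangle_const => A /in_mapP[g gfs ->]; apply: color_closedC.
  by apply: color_closed_truth; exact: all_In gfs.
Qed.

End coloring_theory.

(** * The formulas and the pairs of trees that they separate *)

Definition dia_refl (f : formula) : formula := Mu 0 (Or f (Dia (Var 0))).
Definition box_refl (f : formula) : formula := Nu 0 (And f (Box (Var 0))).

(** The variable 0 is kept for the fixed point binders. The parities make [None], labelled by the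
    odd numbers, satisfy every [q_ n] and no [p_ n]. *)
Definition p_ (n : nat) : nat := n.*2.+2.
Definition q_ (n : nat) : nat := n.*2.+1.
Definition layer (v : nat) : nat := v.-1./2.

Lemma layer_p n : layer (p_ n) = n.
Proof. by rewrite /layer /p_ /= uphalf_double. Qed.

Lemma layer_q n : layer (q_ n) = n.
Proof. by rewrite /layer /q_ /= doubleK. Qed.

Lemma p_neq_q m n : p_ m <> q_ n.
Proof. by move=> /(congr1 odd); rewrite /p_ /q_ /= !odd_double. Qed.

Fixpoint theta (n : nat) : formula :=
  if n is m.+1 then
    dia_refl (And (Var (p_ n)) (box_refl (Or (Var (q_ n)) (theta m))))
  else Var (p_ 0).

Lemma fsize_theta n : fsize (theta n) = (12 * n).+1.
Proof. by elim: n => //= n ->; lia. Qed.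

Lemma neg_occurs_theta v n : ~~ neg_occurs v (theta n).
Proof. by elim: n => //= n /negbTE ->. Qed.

Lemma in_Lmu_theta n : in_Lmu (theta n).
Proof. by elim: n => //= n ->; rewrite (negbTE (neg_occurs_theta _ _)). Qed.

(** The hypothesis says that [f] does not depend on the variable 0. By [rho_rho] the iteration is
    stationary after one application of [rho]. *)
Lemma truth_dia_refl (X : convergence_space) (V : X -> set nat) f (A : set X) :
  (forall Y, truth (update V 0 Y) f = A) -> truth V (dia_refl f) = A `|` rho A.
Proof.
move=> fA; rewrite /dia_refl /=; apply/seteqP; split => x.
  move=> /(_ (A `|` rho A)); apply; rewrite /= fA; apply: setUS.
  rewrite [X in rho X](_ : _ = A `|` rho A); last by apply/seteqP; split.
  by rewrite rhoU => y [|/rho_rho].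
move=> Ax Y /=; rewrite fA => YP; apply: (YP).
have AY : A `<=` Y by move=> y Ay; apply: YP; left.
case: Ax => [|Ax]; first by left.
by right; apply: rho_mono Ax => y /AY.
Qed.

Lemma truth_box_refl (X : convergence_space) (V : X -> set nat) f (A : set X) :
  (forall Y, truth (update V 0 Y) f = A) ->
  truth V (box_refl f) = A `&` ~` rho (~` A).
Proof.
move=> fA; rewrite /box_refl /=; apply/seteqP; split => x.
  move=> [Y /=]; rewrite fA => YP /YP[Ax nY]; split => //.
  by apply: contra_not nY; apply: rho_mono => y nAy /YP[].
move=> Ax; exists (A `&` ~` rho (~` A)) => //=; rewrite fA => y [Ay nA].
split=> //; set B := (X in rho (~` X)).
have -> : ~` B = ~` A `|` rho (~` A).
  rewrite /B; apply/seteqP; split => z /=; rewrite /mkset /=.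
    by move=> /not_andP[|/contrapT]; [left|right].
  by move=> [nAz []//|rz []].
by rewrite rhoU => -[|/rho_rho].
Qed.

Fixpoint theta_colors (b : bool) (n : nat) : set color :=
  if n is m.+1 then
    let B := [set w | color_label w (q_ n)] `|` theta_colors b m in
    let C := [set w | color_label w (p_ n)] `&` (B `&` ~` pre b (~` B)) in
    C `|` pre b C
  else [set w | color_label w (p_ 0)].

(** Only nonzero variables are constrained, so that the induction passes under the binders, which
    reinterpret 0. *)
Lemma truth_theta b (X : convergence_space) (f : X -> color) n V :
  coloring b f ->
  (forall x v, V x v.+1 = color_label (f x) v.+1) ->
  truth V (theta n) = f @^-1` theta_colors b n.
Proof.
move=> fP; elim: n V => [|n IH] V VP.
  by apply/seteqP; split => x; rewrite /= /mkset VP.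
rewrite [theta n.+1]/= [theta_colors b n.+1]/=.
set B := _ `|` theta_colors b n; set C := _ `&` _.
rewrite (@truth_dia_refl _ _ _ (f @^-1` C)) ?(rho_preimage fP)// => Y.
have truth_And W g h : @truth X W (And g h) = truth W g `&` truth W h by [].
rewrite truth_And (@truth_box_refl _ _ _ (f @^-1` B)).
  rewrite preimage_setC (rho_preimage fP).
  by apply/seteqP; split => x; rewrite /setI /preimage /mkset /update /p_ /= /mkset /= VP.
move=> Z /=; rewrite (IH _ _) => //.
by apply/seteqP; split => x; rewrite /setU /preimage /mkset /update /q_ /= /mkset /= VP.
Qed.

(* The first component is to satisfy [theta (size s)], the second one is not.
   [L] and [D] are added to the labels at the root, resp. above it; they carry
   the variables of the outer layers. *)
Fixpoint tree_pair (s : seq bool) (L D : set nat) : tree * tree :=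
  if s is x :: s' then
    let n := size s in
    let D' := q_ n |` D in
    let: (a, b) := tree_pair s' (if x then p_ n |` D else D) D' in
    let: (a', b') := tree_pair s' D' D' in
    if x then (Node L a b a', Node L b a' a')
    else let L' := p_ n |` (q_ n |` L) in (Node L' a b' b', Node L' a b b')
  else (Leaf (p_ 0 |` L), Leaf L).

(** [L] enters the label of the root only. Hence the two recursive pairs in [tree_pair] have the
    same proper descendants. *)
Lemma desc_tree_pair s L L' D u :
  (desc (tree_pair s L D).1 u -> desc (tree_pair s L' D).1 u) /\
  (desc (tree_pair s L D).2 u -> desc (tree_pair s L' D).2 u).
Proof.
by case: s => [|[] s] //=; case: (tree_pair s _ _) => a c;
  case: (tree_pair s _ _) => a' c' /=.
Qed.

(** Let [(a, c)] and [(a', c')] be the recursive pairs. Descendants of [a] and [c] are also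
    descendants of [a'] and [c']. So at a [Dia] layer only [a] is seen by the first root alone, and
    [c] answers it; at a [Box] layer only [c] is seen by the second root alone, and [a] answers
    it. *)
Lemma forced_tree_pair b s L D :
  forced b s (Some (tree_pair s L D).1) (Some (tree_pair s L D).2).
Proof.
have or3E (P Q R : Prop) : [\/ P, Q | R] <-> P \/ Q \/ R.
  by split=> [[]|[|[]]]; auto; [constructor 1|constructor 2|constructor 3].
elim: s L D => [|x s IH] L D /=; first by case.
set D' := q_ _ |` D.
have ds u := @desc_tree_pair s (if x then p_ (size s).+1 |` D else D) D' D' u.
have := IH (if x then p_ (size s).+1 |` D else D) D'; move: ds.
case: (tree_pair s _ D') => a c /=.
case: (tree_pair s D' D') => a' c' /= ds sac.
case: x {IH} ds sac => ds sac /=; split => //.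
- by case=> //= u; rewrite !or3E; intuition.
- exists (Some a), (Some c); split => //=; first by rewrite !or3E; auto.
  case=> [u|]/=; last by right.
  by have [d1 d2] := ds u; rewrite !or3E; intuition; subst; auto.
- by case=> //= u; rewrite !or3E; intuition.
- exists (Some a), (Some c); split => //=; first by rewrite !or3E; auto.
  case=> [u|]/=; last by right.
  by have [d1 d2] := ds u; rewrite !or3E; intuition; subst; auto.
Qed.

Definition outer (n : nat) (L : set nat) : Prop := forall v, L v -> (n < layer v)%N.

(** Each stage adds variables of its own layer only, so outer variables pass through unchanged. *)
Lemma label_tree_pair s L D v : (size s < layer v)%N ->
  [/\ label (tree_pair s L D).1 v = L v, label (tree_pair s L D).2 v = L v
   & forall u, desc (tree_pair s L D).1 u \/ desc (tree_pair s L D).2 u ->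
       label u v = D v].
Proof.
elim: s L D => [|x s IH] L D /= vs.
  split=> //; last by move=> u [].
  apply/propext; split; last by right.
  by case=> [vp|//]; move: vs; rewrite vp layer_p.
set D' := q_ _ |` D.
have D'v : D' v = D v.
  apply/propext; split; last by right.
  by case=> [vq|//]; move: vs; rewrite vq layer_q ltnn.
have L'v : (p_ (size s).+1 |` D) v = D v.
  apply/propext; split; last by right.
  by case=> [vp|//]; move: vs; rewrite vp layer_p ltnn.
have L''v : (p_ (size s).+1 |` (q_ (size s).+1 |` L)) v = L v.
  apply/propext; split; last by right; right.
  by case=> [vp|[vq|//]]; move: vs; rewrite ?vp ?vq ?layer_p ?layer_q ltnn.
have := IH (if x then p_ (size s).+1 |` D else D) D' (ltnW vs).
have := IH D' D' (ltnW vs).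
have -> : (if x then p_ (size s).+1 |` D else D) v = D v by case: x.
rewrite D'v.
case: (tree_pair s D' D') => a' c' /=.
case: (tree_pair s _ D') => a c /= [a'v c'v d'] [av cv d].
case: x {IH} => /=; split => //.
- by move=> u; move: (d u) (d' u) => ? ? [[[->|->|->]|[]]|[[->|->|->]|[]]]; auto.
- by move=> u; move: (d u) (d' u) => ? ? [[[->|->|->]|[]]|[[->|->|->]|[]]]; auto.
Qed.

(** All proper descendants of the children, and [a'] and [c'] themselves, carry the new [q_] and
    lack the new [p_]. So [B] holds at [a] by induction and fails only at [c]. At a [Dia] layer [a]
    and [c] carry [p_], and only the first root sees [a]; at a [Box] layer only the roots carry
    [p_], and only the second one sees [c]. *)
Lemma theta_tree_pair b s L D : outer (size s) L -> outer (size s) D ->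
  theta_colors b (size s) (Some (tree_pair s L D).1) /\
  ~ theta_colors b (size s) (Some (tree_pair s L D).2).
Proof.
elim: s L D => [|x s IH] L D /= oL oD.
  split; first by left.
  by move/oL; rewrite layer_p.
set n := (size s).+1; set D' := q_ _ |` D.
set B := _ `|` theta_colors b (size s); set C := _ `&` _.
have oD' : outer (size s) D'.
  by move=> v [->|/oD/ltnW//]; rewrite layer_q.
have oL' : outer (size s) (if x then p_ n |` D else D).
  by move=> v; case: x => [[->|]|] => [|/oD/ltnW//|/oD/ltnW//]; rewrite layer_p.
have pN M : outer n M -> ~ M (p_ n) by move=> oM /oM; rewrite layer_p ltnn.
have qN M : outer n M -> ~ M (q_ n) by move=> oM /oM; rewrite layer_q ltnn.
have pD' : ~ D' (p_ n) by move=> [/p_neq_q//|]; exact: pN.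
have qD' : D' (q_ n) by left.
have lp : (size s < layer (p_ n))%N by rewrite layer_p.
have lq : (size s < layer (q_ n))%N by rewrite layer_q.
have [] := IH _ D' oL' oD'.
have := label_tree_pair (if x then p_ n |` D else D) D' lp.
have := label_tree_pair (if x then p_ n |` D else D) D' lq.
have := label_tree_pair D' D' lp.
have := label_tree_pair D' D' lq.
case: (tree_pair s D' D') => a' c' /=.
case: (tree_pair s _ D') => a c /= [a'q c'q d'q] [a'p c'p d'p].
move=> [aq cq dq] [ap cp dp] ta tc.
have CNone : ~ C None by rewrite /C /= => -[]; rewrite /mkset /= /p_ /= odd_double.
have BNone : B None by left; rewrite /mkset /= /q_ /= odd_double.
have inB u : desc a u \/ desc c u \/ desc a' u \/ desc c' u -> B (Some u).
  move=> du; left; rewrite /mkset /=.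
  by case: du => [|[|[|]]] du; [rewrite dq|rewrite dq|rewrite d'q|rewrite d'q]; auto.
have notC u : desc a u \/ desc c u \/ desc a' u \/ desc c' u -> ~ C (Some u).
  move=> du []; rewrite /mkset /= => + _.
  by case: du => [|[|[|]]] du; [rewrite dp|rewrite dp|rewrite d'p|rewrite d'p]; auto.
have Ca' : ~ C (Some a') by move=> []; rewrite /mkset /= a'p.
have Cc' : ~ C (Some c') by move=> []; rewrite /mkset /= c'p.
have Ba' : B (Some a') by left; rewrite /mkset /= a'q.
have Bc' : B (Some c') by left; rewrite /mkset /= c'q.
have Ba : B (Some a) by right.
case: x oL' aq cq ap cp {IH} => /= oL' aq cq ap cp; split.
- right; exists (Some a); last by left; constructor 1.
  split; first by rewrite /mkset /= ap; left.
  split => // -[[u|]] //= nB au; apply: nB; apply: inB; auto.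
- have Bc : ~ B (Some c).
    by case=> //; rewrite /mkset /= cq => -[/esym/p_neq_q//|]; exact: qN.
  case=> [[]|[[u|] // Cu]]; first by rewrite /mkset /= => /(pN _ oL).
  move=> /= [[uE|uE|uE]|du]; last by apply: notC Cu; case: du; auto.
  + by move: Cu; rewrite uE => -[_ []].
  + by rewrite uE in Cu.
  + by rewrite uE in Cu.
- left; split; first by left.
  split; first by left; right; left.
  move=> -[[u|]] //= nB [[uE|uE|uE]|du]; apply: nB; rewrite ?uE //.
  by apply: inB; case: du; auto.
- have Bc : ~ B (Some c).
    by case=> //; rewrite /mkset /= cq; exact: qN.
  case=> [[_ [_]]|[[u|] // Cu]].
    by apply; exists (Some c) => //=; left; constructor 2.
  move=> /= [[uE|uE|uE]|du]; last by apply: notC Cu; case: du; auto.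
  + by move: Cu; rewrite uE => -[]; rewrite /mkset /= ap => /(pN _ oD).
  + by move: Cu; rewrite uE => -[]; rewrite /mkset /= cp => /(pN _ oD).
  + by rewrite uE in Cu.
Qed.

(** * Trees of uniform depth and the size bound *)

Fixpoint perfect (k : nat) (t : tree) : Prop :=
  match k, t with
  | 0, Leaf _ => True
  | k'.+1, Node _ t1 t2 t3 => [/\ perfect k' t1, perfect k' t2 & perfect k' t3]
  | _, _ => False
  end.

Lemma perfect_tree_pair s L D :
  perfect (size s) (tree_pair s L D).1 /\ perfect (size s) (tree_pair s L D).2.
Proof.
elim: s L D => //= x s IH L D; set D' := q_ _ |` D.
have := IH D' D'; case: (tree_pair s D' D') => a' c' /= [].
have := IH (if x then p_ (size s).+1 |` D else D) D'.
by case: (tree_pair s _ D') => a c /= []; case: x.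
Qed.

(** [b] is chosen per class: [false] for GL frames and ordinals, [true] where every point must have
    a successor. *)
Definition realizable (C : convergence_space -> Prop) (t : tree) : Prop :=
  exists (b : bool) (X : convergence_space) (f : X -> color) (x : X),
    [/\ C X, coloring b f & f x = Some t].

Lemma fsize_lower_bound (C : convergence_space -> Prop) n psi :
  (forall k t, perfect k t -> realizable C t) ->
  in_Ltangle_forall psi -> equivalent C (theta n.+1) psi ->
  (2 ^ n.+2 <= fsize psi)%N.
Proof.
move=> real Lpsi eq_psi; apply: fsize_all_paths => s sn.
have := forced_tree_pair _ s set0 set0.
have [pa pc] := perfect_tree_pair s set0 set0.
have o0 : outer (size s) set0 by [].
have := fun b => theta_tree_pair b o0 o0.
case: (tree_pair s _ _) pa pc => a c /= pa pc tac sac.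
(* A common root puts both trees into one model; the third child is padding. *)
have [b [X [f [x [CX fP fx]]]]] := real _ _ (And3 pa pc pc : perfect _.+1 (Node set0 a c c)).
have [y fy] : exists y, f y = Some a.
  by apply: (below_surj fP (x := x)); rewrite fx; left; constructor 1.
have [z fz] : exists z, f z = Some c.
  by apply: (below_surj fP (x := x)); rewrite fx; left; constructor 2.
have := eq_psi _ CX (color_label \o f); rewrite (truth_theta _ fP)// => eqV.
have [ta tc] := tac b; rewrite sn in ta tc.
apply: (forced_path fP (x := y) (y := z)) => //; first by rewrite fy fz.
- by rewrite -eqV /preimage /mkset fy.
- by rewrite -eqV /preimage /mkset fz.
Qed.

(** * Kripke frames *)

HB.instance Definition _ := gen_eqMixin tree.

(** Positions in this list serve as the points of finite frames; repeated subtrees become distinct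
    points of one colour. *)
Fixpoint nodes (t : tree) : seq tree :=
  t :: if t is Node _ t1 t2 t3 then nodes t1 ++ nodes t2 ++ nodes t3 else [::].

Lemma mem_nodes t u : u \in nodes t <-> t = u \/ desc t u.
Proof.
elim: t u => [l|l t1 I1 t2 I2 t3 I3] u.
  rewrite inE; split => [/eqP->|[<-|//]]; [by left|by rewrite eqxx].
rewrite [nodes _]/= inE !mem_cat /=; split.
  case/orP => [/eqP->|/or3P[/I1|/I2|/I3] [<-|d]]; [by left|right..].
  - by left; constructor 1.
  - by right; constructor 1.
  - by left; constructor 2.
  - by right; constructor 2.
  - by left; constructor 3.
  - by right; constructor 3.
case=> [<-|uP]; first by rewrite eqxx.
suff -> : [|| u \in nodes t1, u \in nodes t2 | u \in nodes t3] by rewrite orbT.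
case: uP => [[->|->|->]|[d|d|d]]; apply/or3P.
- by constructor 1; apply/I1; left.
- by constructor 2; apply/I2; left.
- by constructor 3; apply/I3; left.
- by constructor 1; apply/I1; right.
- by constructor 2; apply/I2; right.
- by constructor 3; apply/I3; right.
Qed.

Section kripke_realization.
Variable t : tree.

Let node (i : 'I_(size (nodes t))) : tree := nth t (nodes t) i.

Let node_surj u : u \in nodes t -> exists i, node i = u.
Proof.
rewrite -index_mem => u_t; exists (Ordinal u_t).
by rewrite /node /= nth_index// -index_mem.
Qed.

Let node_desc i u : desc (node i) u -> exists j, node j = u.
Proof.
move=> d; apply: node_surj; apply/mem_nodes; right.
have /mem_nodes[ti|ti] : node i \in nodes t by exact: mem_nth.
  by rewrite ti.
exact: desc_trans ti d.
Qed.

Definition tree_rel : rel 'I_(size (nodes t)) := [rel i j | `[< desc (node i) (node j) >]].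

Lemma tree_rel_trans : transitive tree_rel.
Proof.
by move=> j i k /asboolP ij /asboolP jk; apply/asboolP; exact: desc_trans jk.
Qed.

Lemma tree_rel_irr : irreflexive tree_rel.
Proof. by move=> i; apply/asboolP => /desc_irr. Qed.

Lemma GL_realizable (C : convergence_space -> Prop) :
  (forall (W : finType) (r : rel W) (r_trans : transitive r),
    irreflexive r -> C (kripke_space r_trans)) -> realizable C t.
Proof.
move=> CGL.
have [i it] : exists i, node i = t by apply: node_surj; apply/mem_nodes; left.
exists false, (kripke_space tree_rel_trans), (Some \o node), i.
split; [exact: CGL tree_rel_irr| |by rewrite /= it].
split=> [A x [y Ay /asboolP xy]|x [u|] //= d]; first by exists y.
have [j ju] := node_desc d; exists j; first by rewrite /preimage /= ju.
by apply/asboolP; rewrite ju.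
Qed.

Definition tree_top_rel : rel (option 'I_(size (nodes t))) := fun w u =>
  match w, u with
  | Some i, Some j => tree_rel i j
  | _, None => true
  | None, Some _ => false
  end.

Lemma tree_top_rel_trans : transitive tree_top_rel.
Proof. by move=> [j|] [i|] [k|] //=; exact: tree_rel_trans. Qed.

Lemma tree_top_rel_None w : tree_top_rel w None.
Proof. by case: w. Qed.

(** The reflexive top point gives seriality, and any two points, also within a set of successors,
    are joined through it. *)
Lemma TC_realizable (C : convergence_space -> Prop) :
  (forall (W : finType) (r : rel W) (r_trans : transitive r),
    serial r -> connected_frame r -> locally_connected_frame r ->
    C (kripke_space r_trans)) -> realizable C t.
Proof.
move=> CTC.
have [i it] : exists i, node i = t by apply: node_surj; apply/mem_nodes; left.
exists true, (kripke_space tree_top_rel_trans), (omap node), (Some i).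
split; last by rewrite /= it.
- apply: CTC.
  + by move=> w; exists None; exact: tree_top_rel_None.
  + move=> w u; apply: (@connect_trans _ _ None); apply: connect1 => /=.
      by rewrite tree_top_rel_None.
    by rewrite tree_top_rel_None orbT.
  + move=> w u v wu wv; apply: (@connect_trans _ _ None); apply: connect1 => /=.
      by rewrite wu !tree_top_rel_None.
    by rewrite wv !tree_top_rel_None orbT.
- split=> [A x [y Ay xy]|x w xw].
    by exists y => //; case: x y xy {Ay} => [?|] [?|] //= /asboolP.
  case: w x xw => [u|] x xw; last by exists None => //; exact: tree_top_rel_None.
  case: x xw => [j|//] /= d; have [k ku] := node_desc d.
  by exists (Some k); [rewrite /preimage /= ku|apply/asboolP; rewrite ku].
Qed.

End kripke_realization.

(** [desc] is the transitive closure of [child], and [rho_rho] composes the steps along a path. *)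
Lemma coloring_child (b : bool) (X : convergence_space) (f : X -> color) :
  (forall A x, rho A x -> exists2 y, A y & below b (f x) (f y)) ->
  (forall x t u, f x = Some t -> child t u -> rho (f @^-1` [set Some u]) x) ->
  (b -> forall x, rho (f @^-1` [set None]) x) ->
  coloring b f.
Proof.
move=> forth backc backN; split=> // x [u|]; last by case: (f x) => //= *; exact: backN.
case fx: (f x) => [t|//] /=.
elim/desc_ind: t x fx => t IH x fx /descP[c tc [<-|cu]]; first exact: backc fx tc.
apply: rho_rho; apply: rho_mono (backc _ _ _ fx tc) => y /= fy.
by apply: IH (child_desc tc) _ fy cu.
Qed.

(** * Ordinals below omega^omega *)

(* [c] stands for omega^(k-1) c_(k-1) + ... + omega c_1 + c_0; its digits from
   [k] on are ignored. *)
Fixpoint nz (k : nat) (c : nat -> nat) : bool :=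
  if k is k'.+1 then (0 < c k')%N || nz k' c else false.

Fixpoint ltd (k : nat) (c d : nat -> nat) : bool :=
  if k is k'.+1 then (c k' < d k')%N || (c k' == d k') && ltd k' c d else false.

(** The children are enumerated cyclically, so that each one recurs at arbitrarily large indices. *)
Definition kid (t : tree) (a : nat) : tree :=
  if t is Node _ t1 t2 t3 then
    match (a %% 3)%N with 0 => t1 | 1 => t2 | _ => t3 end
  else t.

(* The root [t] sits at [omega^k]; the interval
   (omega^(k-1) a, omega^(k-1) (a + 1)] carries a copy of [kid t a] whose root
   sits at the right end point. *)
Fixpoint digit_color (k : nat) (t : tree) (c : nat -> nat) : tree :=
  if k is k'.+1 then
    if nz k' c || (c k' == 0)%N then digit_color k' (kid t (c k')) c
    else kid t (c k').-1
  else t.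

Definition set_digit (k a : nat) (c : nat -> nat) : nat -> nat :=
  fun j => if j == k then a else c j.

Lemma nz_ext k c d : (forall j, (j < k)%N -> c j = d j) -> nz k c = nz k d.
Proof. by elim: k => //= k IH cd; rewrite cd// IH// => j jk; rewrite cd// ltnW. Qed.

Lemma ltd_ext k c c' d d' : (forall j, (j < k)%N -> c j = c' j) ->
  (forall j, (j < k)%N -> d j = d' j) -> ltd k c d = ltd k c' d'.
Proof.
elim: k => //= k IH cc' dd'; rewrite cc'// dd'// IH// => j jk.
  by rewrite cc'// ltnW.
by rewrite dd'// ltnW.
Qed.

Lemma digit_color_ext k t c d : (forall j, (j < k)%N -> c j = d j) ->
  digit_color k t c = digit_color k t d.
Proof.
elim: k t => //= k IH t cd.
have cd' j : (j < k)%N -> c j = d j by move=> jk; rewrite cd// ltnW.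
by rewrite cd// (nz_ext cd') (IH _ cd').
Qed.

Lemma ltd_nz k c d : ltd k c d -> nz k d.
Proof.
elim: k => //= k IH /orP[cd|/andP[_ /IH ->]]; last by rewrite orbT.
by rewrite (leq_ltn_trans _ cd).
Qed.

Lemma set_digit_id k a c : set_digit k a c k = a.
Proof. by rewrite /set_digit eqxx. Qed.

Lemma set_digit_lt k a c j : (j < k)%N -> set_digit k a c j = c j.
Proof. by rewrite /set_digit => /ltn_eqF ->. Qed.

Lemma perfect_kid k t a : perfect k.+1 t -> perfect k (kid t a).
Proof. by case: t => //= l t1 t2 t3 [? ? ?]; case: (a %% 3)%N => [|[]]. Qed.

Lemma child_kid k t a : perfect k.+1 t -> child t (kid t a).
Proof.
case: t => //= l t1 t2 t3 _; case: (a %% 3)%N => [|[]];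
  by [constructor 1|constructor 2|move=> *; constructor 3].
Qed.

Lemma kid_child t u z : child t u ->
  exists2 a, (z <= a)%N & kid t a = u.
Proof.
case: t => //= l t1 t2 t3 [->|->|->].
- by exists (z * 3)%N; [lia|rewrite modnMl].
- by exists (z * 3 + 1)%N; [lia|rewrite modnMDl].
- by exists (z * 3 + 2)%N; [lia|rewrite modnMDl].
Qed.

Lemma digit_color_desc k t c : perfect k t -> nz k c -> desc t (digit_color k t c).
Proof.
elim: k t => //= k IH t pt; have pk := perfect_kid _ pt.
case: ifP => [nc0 nc|_ _]; last by apply: child_desc; exact: child_kid pt.
apply: desc_trans (IH _ (pk (c k)) _).
  by apply: child_desc; exact: child_kid pt.
by move: nc nc0; case: (c k) => [|a] /=; rewrite ?orbF.
Qed.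

Lemma digit_color_child k t u z : perfect k t -> child t u ->
  exists2 d, ltd k z d & digit_color k t d = u.
Proof.
case: k => [|k] pt tu; first by case: t pt tu.
have [a za au] := kid_child (z k) tu.
(* The right end point of interval number [a] has leading digit [a.+1], beyond that of [z]. *)
exists (set_digit k a.+1 (fun=> 0%N)); first by rewrite /= set_digit_id ltnS za.
have nz0 j : nz j (fun=> 0%N) = false by elim: j.
by rewrite /= (nz_ext (set_digit_lt _ _)) nz0 set_digit_id.
Qed.

(** The ordinal 0 lies in none of the half-open intervals; [digit_color] sends it down to a leaf.
    This matches the exclusion of 0 in [ordinal_rho]. *)
Lemma child_digit_color k t c u : perfect k t -> child (digit_color k t c) u -> nz k c.
Proof.
elim: k t => [|k IH] t pt /=; first by case: t pt.
case: ifP => [_ /(IH _ (perfect_kid _ pt)) ->|]; first by rewrite orbT.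
by rewrite lt0n; case: eqP => //; rewrite orbT.
Qed.

(** If [c] is interior to an interval, a bound is found there by induction. If [c] is a right end
    point, [z] is the left end point, and all that lies between belongs to the copy of one child. *)
Lemma digit_color_forth k t c : perfect k t -> nz k c ->
  exists2 z, ltd k z c & forall d, ltd k z d -> ltd k d c ->
    desc (digit_color k t c) (digit_color k t d).
Proof.
elim: k t c => // k IH t c pt /=; have pk := perfect_kid _ pt.
case nc: (nz k c) => /=.
  move=> _; have [z zc zP] := IH _ c (pk (c k)) nc.
  exists (set_digit k (c k) z).
    by rewrite set_digit_id eqxx (ltd_ext (set_digit_lt _ _) (fun _ _ => erefl)) zc orbT.
  move=> d; rewrite set_digit_id (ltd_ext (set_digit_lt _ _) (fun _ _ => erefl)).
  move=> zd dc; have [dkE zd' dc'] : [/\ d k = c k, ltd k z d & ltd k d c].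
    by move: zd dc; case: (ltngtP (c k) (d k)).
  by rewrite dkE (ltd_nz zd') /=; exact: zP.
rewrite orbF => c0; rewrite gtn_eqF//=.
exists (set_digit k (c k).-1 (fun=> 0%N)); first by rewrite set_digit_id prednK// leqnn.
move=> d; rewrite set_digit_id (ltd_ext (set_digit_lt _ _) (fun _ _ => erefl)).
move=> zd dc; have dc' : (d k < c k)%N.
  by case/orP: dc => // /andP[_ /ltd_nz]; rewrite nc.
have [dkE zd'] : d k = (c k).-1 /\ ltd k (fun=> 0%N) d.
  case/orP: zd => [|/andP[/eqP -> ->]//].
  by rewrite -ltnS prednK// ltnS leqNgt dc'.
rewrite (ltd_nz zd') dkE /=; apply: digit_color_desc => //; exact: ltd_nz zd'.
Qed.

Lemma digit_color_back k t c u z : perfect k t -> child (digit_color k t c) u ->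
  ltd k z c -> exists d, [/\ ltd k z d, ltd k d c & digit_color k t d = u].
Proof.
elim: k t c z => // k IH t c z pt /=; have pk := perfect_kid _ pt.
case nc: (nz k c) => /=.
  move=> cu zc.
  (* A bound inside the interval of [c]: [z] itself if its leading digit agrees, otherwise anything
     below [c], as [z] is then below all ordinals with that leading digit. *)
  have [z' z'c zz'] : exists2 z', ltd k z' c & forall d, ltd k z' d ->
      (z k < c k)%N || (z k == c k) && ltd k z d.
    case/orP: zc => [zc|/andP[-> zc]].
      by have [z' ? _] := digit_color_forth (pk (c k)) nc; exists z' => // d; rewrite zc.
    by exists z => // d ->; rewrite orbT.
  have [d [zd dc du]] := IH _ _ _ (pk (c k)) cu z'c.
  have dE := @set_digit_lt k (c k) d.
  exists (set_digit k (c k) d); rewrite set_digit_id eqxx ltnn /=.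
  rewrite (ltd_ext (fun _ _ => erefl) dE) (ltd_ext dE (fun _ _ => erefl)).
  by rewrite (nz_ext dE) (ltd_nz zd) (digit_color_ext _ dE) zz'.
case: ifP => [/eqP c0|c0] cu zc.
  case/orP: zc => [|/andP[_ /ltd_nz]]; by rewrite ?c0 ?nc.
have {}zc : (z k < c k)%N by case/orP: zc => // /andP[_ /ltd_nz]; rewrite nc.
have [d zd du] := digit_color_child z (pk (c k).-1) cu.
have dE := @set_digit_lt k (c k).-1 d.
exists (set_digit k (c k).-1 d); rewrite set_digit_id.
rewrite (ltd_ext (fun _ _ => erefl) dE) (nz_ext dE) (ltd_nz zd) (digit_color_ext _ dE).
have ck0 : (0 < c k)%N by exact: leq_ltn_trans zc.
split=> //=; last by rewrite prednK// leqnn.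
by rewrite zd andbT orbC -leq_eqVlt -ltnS prednK.
Qed.

Lemma olt_ltd k (x y : ordinal_ww) : (size x <= k)%N -> (size y <= k)%N ->
  olt x y <-> ltd k (nth 0%R x) (nth 0%R y).
Proof.
move=> sx sy; pose eq_above m := forall j, (m <= j)%N -> x`_j = y`_j.
suff H m : eq_above m -> olt x y <-> ltd m (nth 0%R x) (nth 0%R y).
  by apply: H => j kj; rewrite !nth_default// (leq_trans _ kj).
elim: m => [|m IH] eqm /=.
  by split => // -[i]; rewrite eqm// ltnn.
split.
- move=> [i xy eqi]; case: (ltngtP i m) => im.
  + have xym : x`_m = y`_m by exact: eqi.
    rewrite xym eqxx /= orbC; apply/orP; left; apply/IH; last by exists i.
    by move=> j; rewrite leq_eqVlt => /predU1P[<-//|]; exact: eqm.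
  + by move: xy; rewrite eqm// ltnn.
  + by rewrite -im xy.
- case/orP => [xy|/andP[/eqP xy l]]; first by exists m.
  by apply/IH => // j; rewrite leq_eqVlt => /predU1P[<-//|]; exact: eqm.
Qed.

Lemma olt_Xn k (x : ordinal_ww) : olt x 'X^k <-> (size x <= k)%N.
Proof.
split=> [[i xi xj]|xk].
  have ik : i = k by move: xi; rewrite coefXn; case: eqP.
  apply/leq_sizeP => j; rewrite leq_eqVlt => /predU1P[<-|kj].
    by move: xi; rewrite ik coefXn eqxx ltnS leqn0 => /eqP.
  by rewrite xj ?ik// coefXn gtn_eqF.
exists k; first by rewrite coefXn eqxx nth_default.
move=> j kj; rewrite coefXn gtn_eqF// nth_default//.
exact: leq_trans xk (ltnW kj).
Qed.

Lemma nz_poly k (x : ordinal_ww) : (size x <= k)%N -> x <> 0%R -> nz k (nth 0%R x).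
Proof.
move=> xk /olt0; have s0 : (size (0%R : ordinal_ww) <= k)%N by rewrite size_poly0.
by move/(olt_ltd s0 xk)/ltd_nz.
Qed.

Lemma ltd_coef_poly k (c : nat -> nat) d :
  ltd k (nth 0%R (\poly_(i < k) c i)) d = ltd k c d /\
  ltd k d (nth 0%R (\poly_(i < k) c i)) = ltd k d c.
Proof. by split; apply: ltd_ext => // j jk; rewrite coef_poly jk. Qed.

Section ordinal_realization.
Variables (k : nat) (t : tree).
Hypothesis pt : perfect k t.

(* [t] is the colour of [omega^k]. *)
Let ordinal_color (x : ordinal_space 'X^(k.+1)) : color :=
  Some (digit_color k.+1 (Node set0 t t t) (nth 0%R (sval x))).

Let point (x : ordinal_ww) (xk : (size x <= k.+1)%N) : ordinal_space 'X^(k.+1) :=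
  exist (fun y => olt y 'X^(k.+1)) x ((olt_Xn k.+1 x).2 xk).

Let pt' : perfect k.+1 (Node set0 t t t). Proof. by []. Qed.

Let size_point (x : ordinal_space 'X^(k.+1)) : (size (sval x) <= k.+1)%N.
Proof. by apply/olt_Xn; exact: (svalP x). Qed.

Lemma ordinal_coloring : coloring false ordinal_color.
Proof.
apply: coloring_child => //.
- move=> A x [x0 xA].
  have [z zx zP] := digit_color_forth pt' (nz_poly (size_point x) x0).
  pose zeta : ordinal_ww := \poly_(i < k.+1) z i.
  have sz : (size zeta <= k.+1)%N by exact: size_poly.
  have [|eta [Aeta zeta_eta eta_x]] := xA zeta.
    by apply/(olt_ltd sz (size_point x)); rewrite (ltd_coef_poly _ _ _).1.
  exists eta => //=; apply: zP.
    by rewrite -(ltd_coef_poly _ _ _).1; apply/(olt_ltd sz (size_point _)).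
  exact/(olt_ltd (size_point _) (size_point _)).
- move=> x _ u [<-] tu; split.
    move=> x0; have := child_digit_color pt' tu; rewrite x0 (@nz_ext _ _ (fun=> 0%N)).
      by elim: (k.+1).
    by move=> j _; rewrite coef0.
  move=> z zx; have sz : (size z <= k.+1)%N.
    by apply/olt_Xn; apply: olt_trans zx (svalP x).
  have [d [zd dx du]] := digit_color_back pt' tu ((olt_ltd sz (size_point x)).1 zx).
  have sd : (size (\poly_(i < k.+1) d i : ordinal_ww) <= k.+1)%N by exact: size_poly.
  exists (point sd); split.
  + rewrite /preimage /mkset /ordinal_color -du; congr Some.
    by apply: digit_color_ext => j jk; rewrite /= coef_poly jk.
  + by apply/(olt_ltd sz sd); rewrite (ltd_coef_poly _ _ _).2.
  + by apply/(olt_ltd sd (size_point x)); rewrite (ltd_coef_poly _ _ _).1.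
Qed.

(** The root of the auxiliary tree [Node set0 t t t] would sit at ['X^(k.+1)], outside the space;
    ['X^k] ends the first interval and gets the colour [t]. *)
Lemma ordinal_realizable (C : convergence_space -> Prop) :
  (forall Lambda : ordinal_ww, C (ordinal_space Lambda)) -> realizable C t.
Proof.
move=> Cord.
have Xk : (size ('X^k : ordinal_ww) <= k.+1)%N by rewrite size_polyXn.
exists false, (ordinal_space 'X^(k.+1)), ordinal_color, (point Xk).
split => //; first exact: ordinal_coloring.
have nzk : nz k (nth 0%R ('X^k : ordinal_ww)) = false.
  rewrite (@nz_ext _ _ (fun=> 0%N)); first by elim: (k).
  by move=> j jk; rewrite coefXn ltn_eqF.
by rewrite /ordinal_color /= nzk coefXn eqxx.
Qed.

End ordinal_realization.

(** * Crowded metric spaces *)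

Section metric_realization.
Variables (R : realType) (X : metricType R).
Hypothesis crowdedX : crowded X.

Let d : X -> X -> R := @mdist R X.

Let dC y z : d y z = d z y. Proof. exact: metric_sym. Qed.

Let d_gt0 y z : y <> z -> 0 < d y z.
Proof. by move=> /eqP yz; rewrite /d mdist_gt0. Qed.

Let d_tri y z w : d y w <= d y z + d z w. Proof. exact: metric_triangle. Qed.

Let dd y : d y y = 0. Proof. exact: mdistxx. Qed.

Lemma limit_pointP (A : set X) y : limit_point A y <->
  forall e : R, 0 < e -> exists z, [/\ z <> y, A z & d y z < e].
Proof.
split=> [yA e e0|yA U].
  have [z [/eqP zy Az]] := yA _ (nbhsx_ballx y e e0).
  by rewrite ballEmdist => yz; exists z.
rewrite -nbhs_ballE => -[e /= e0 eU]; have [z [zy Az yz]] := yA e e0.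
by exists z; split => //; [exact/eqP|apply: eU; rewrite ballEmdist].
Qed.

Lemma crowded_near y (e : R) : 0 < e -> exists2 z, z <> y & d y z < e.
Proof.
move=> e0; have : closure [set: X] y by rewrite closureT.
rewrite closure_isolated_limit_point; case.
  by move: crowdedX; rewrite /crowded => ->.
by move=> /limit_pointP/(_ e e0)[z [zy _ yz]]; exists z.
Qed.

(** The hypotheses of [coloring_child] for [b = true], localized at a point so that colourings can
    be glued. *)
Definition coloring_at (f : X -> color) (y : X) : Prop :=
  [/\ exists2 e, 0 < e &
        forall z, d y z < e -> z <> y -> below true (f y) (f z),
      forall t u, f y = Some t -> child t u -> limit_point (f @^-1` [set Some u]) y
    & limit_point (f @^-1` [set None]) y].

Lemma coloring_at_near f g y (e : R) : 0 < e -> (forall z, d y z < e -> f z = g z) ->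
  coloring_at g y -> coloring_at f y.
Proof.
move=> e0 fg [[e' e'0 below_g] child_g top_g].
have fgy : f y = g y by apply: fg; rewrite dd.
have near (B : set color) : limit_point (g @^-1` B) y -> limit_point (f @^-1` B) y.
  move=> /limit_pointP gB; apply/limit_pointP => r r0.
  have [|z [zy gz]] := gB (Num.min r e); first by rewrite lt_min r0 e0.
  rewrite lt_min => /andP[zr ze]; exists z; split => //.
  by rewrite /preimage /mkset fg.
split; last exact: near.
- exists (Num.min e e'); first by rewrite lt_min e0 e'0.
  move=> z; rewrite lt_min => /andP[ze ze'] zy.
  by rewrite fgy fg//; exact: below_g.
- by move=> t u; rewrite fgy => gy tu; apply: near; exact: child_g gy tu.
Qed.

Lemma leaf_coloring t x : (forall u, ~ child t u) ->
  forall y, coloring_at (fun z => if z == x then Some t else None) y.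
Proof.
move=> leaf y; have near_None : limit_point
    ((fun z => if z == x then Some t else None) @^-1` [set None]) y.
  apply/limit_pointP => e e0.
  case: (eqVneq y x) => [<-|/eqP yx].
    have [z zy yz] := crowded_near y e0; exists z; split => //.
    by rewrite /preimage /mkset; case: eqP.
  have [|z zy] := @crowded_near y (Num.min e (d y x)).
    by rewrite lt_min e0 d_gt0.
  rewrite lt_min => /andP[ze zx]; exists z; split => //.
  by rewrite /preimage /mkset; case: eqP => // zxE; move: zx; rewrite zxE ltxx.
split=> //; last by move=> t' u; case: eqP => // _ [<-] /leaf.
case: (eqVneq y x) => [->|/eqP yx].
  by exists 1 => // z _ /eqP/negbTE ->.
exists (d y x); first exact: d_gt0.
by move=> z yz _; case: eqP => // zx; move: yz; rewrite zx ltxx.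
Qed.

(* The points [s j] converge geometrically to [x], and a copy of the [j]-th
   child of [t] is placed in the ball around [s j] of radius [d x (s j) / 4];
   these balls are far from each other on the scale of their distance to [x]. *)
Lemma tree_coloring k t x (e : R) : perfect k t -> 0 < e ->
  exists f : X -> color,
    [/\ f x = Some t,
        forall y, f y <> None -> d x y < e,
        forall y, y <> x -> below true (Some t) (f y)
      & forall y, coloring_at f y].
Proof.
elim: k t x e => [|k IH] t x e pt e0.
  exists (fun z => if z == x then Some t else None); split.
  - by rewrite eqxx.
  - by move=> y; case: eqP => [-> _|_ []//]; rewrite dd.
  - by move=> y /eqP/negbTE ->.
  - by apply: leaf_coloring => u; case: t pt => /= [l _ []|].
have [y|g gP] := @choice X X
    (fun y z => y <> x -> z <> x /\ d x z < d x y / 4%:R).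
  case: (eqVneq y x) => [yx|/eqP yx]; first by exists y.
  have [|z zx xz] := @crowded_near x (d x y / 4%:R).
    by rewrite divr_gt0// d_gt0//; apply/nesym.
  by exists z.
(* The copies reach out to 5/4 of the distance of [x0] from [x], hence stay within [e]. *)
have [x0 x0x xx0] : exists2 y, y <> x & d x y < e / 2%:R.
  by apply: crowded_near; rewrite divr_gt0.
pose s j := iter j g x0; pose r j := d x (s j).
have sx j : s j <> x by elim: j => //= j /gP[].
have r_gt0 j : 0 < r j by apply: d_gt0; apply/nesym.
have rS j : r j.+1 < r j / 4%:R by have [] := gP _ (sx j).
have r_lt i j : (i < j)%N -> r j < r i / 4%:R.
  elim: j => // j IHj; rewrite ltnS leq_eqVlt => /predU1P[->//|/IHj].
  by move: (rS j) (r_gt0 j); lra.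
have r_le0 j : r j < e / 2%:R.
  case: j => [//|j]; have := r_lt 0 j.+1 isT; have := r_gt0 0%N.
  by move: xx0; rewrite -/(r 0%N); lra.
have r_cvg (c : R) : 0 < c -> exists J, forall j, (J <= j)%N -> r j < c.
  (* Decay like 1/(j+1), weaker than the geometric one, suffices for the Archimedean argument. *)
  move=> c0; have rj j : r j * j.+1%:R <= r 0%N.
    elim: j => [|j IHj]; first by rewrite mulr1.
    apply: le_trans IHj; have := rS j; have := r_gt0 j.+1.
    rewrite -[j.+2]addn2 -[j.+1]addn1 !natrD; have : 0 <= j%:R :> R by [].
    rewrite addn1.
    by set a := r j; set b := r j.+1; set n := j%:R => n0 b0 ba; nra.
  exists (Num.truncn (r 0%N / c)) => j Jj; rewrite ltNge; apply/negP => cr.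
  have := truncnS_gt (r 0%N / c); rewrite ltNge => /negP; apply.
  rewrite ler_pdivlMr//; apply: le_trans (rj j).
  have : (Num.truncn (r 0%N / c)).+1%:R <= j.+1%:R :> R by rewrite ler_nat ltnS.
  set m := _.+1%:R; move=> mj; rewrite mulrC.
  by apply: ler_pM => //; exact: ltW.
have [j|F FP] := @choice nat (X -> color) (fun j h =>
    [/\ h (s j) = Some (kid t j),
        forall y, h y <> None -> d (s j) y < r j / 4%:R,
        forall y, y <> s j -> below true (Some (kid t j)) (h y)
      & forall y, coloring_at h y]).
  by apply: IH; [exact: perfect_kid|rewrite divr_gt0].
(* The copy at [s j] lies in the shell between 3/4 and 5/4 of [r j] around [x]. *)
have F_near j y : F j y <> None -> r j * 3%:R < 4%:R * d x y /\ 4%:R * d x y < r j * 5%:R.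
  have [_ Fj _ _] := FP j => /Fj; have := d_tri x (s j) y; have := d_tri x y (s j).
  by rewrite -/(r j) (dC y); split; lra.
have far i j y z : (i < j)%N -> F i y <> None -> F j z <> None ->
    d x z * 2%:R < d x y.
  move=> ij /F_near[iy1 iy2] /F_near[jz1 jz2].
  by move: (r_lt _ _ ij); lra.
pose f y := if y == x then Some t else
  if pselect (exists j, F j y <> None) is left jP then F (sval (cid jP)) y else None.
have fx : f x = Some t by rewrite /f eqxx.
have fF j z : z <> x -> (forall i, F i z <> None -> i = j) -> f z = F j z.
  move=> /eqP/negbTE zx ij; rewrite /f zx; case: pselect => [jP|nj].
    by case: cid => i /= /ij ->.
  by apply: contrapT => /nesym Fjz; apply: nj; exists j.
have uniqF i j z : F i z <> None -> F j z <> None -> i = j.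
  case: (ltngtP i j) => // ij Fi Fj.
    have dz : 0 < d x z by case: (F_near _ _ Fi) => + _; move: (r_gt0 i); lra.
    by exfalso; have := far _ _ _ _ ij Fi Fj; lra.
  have dz : 0 < d x z by case: (F_near _ _ Fi) => + _; move: (r_gt0 i); lra.
  by exfalso; have := far _ _ _ _ ij Fj Fi; lra.
have fF1 j z : z <> x -> F j z <> None -> f z = F j z.
  by move=> zx Fj; apply: fF => // i Fi; exact: uniqF Fi Fj.
have f_cases z : z <> x -> f z = None \/ exists2 j, F j z <> None & f z = F j z.
  move=> zx; case: (pselect (exists j, F j z <> None)) => [[j Fj]|nF].
    by right; exists j => //; exact: fF1.
  left; rewrite (fF 0%N)//; last by move=> i Fi; exfalso; apply: nF; exists i.
  by apply: contrapT => F0; apply: nF; exists 0%N.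
have fs j : f (s j) = Some (kid t j).
  by have [Fs _ _ _] := FP j; rewrite (fF1 j)// Fs.
have f_local y : y <> x -> exists2 c, 0 < c & exists j, forall z, d y z < c -> f z = F j z.
  move=> yx; have dxy : 0 < d x y by apply: d_gt0; exact/nesym.
  (* Within this radius distances to [x] vary by a factor below 9/7, while distinct shells differ by
     a factor above 2; so at most one copy is met. *)
  exists (d x y / 8%:R); first by rewrite divr_gt0.
  have closeP z : d y z < d x y / 8%:R ->
      d x y * 7%:R < d x z * 8%:R /\ d x z * 8%:R < d x y * 9%:R.
    by have := d_tri x y z; have := d_tri x z y; rewrite (dC z); split; lra.
  have near_x z : d y z < d x y / 8%:R -> z <> x.
    by move=> /closeP[+ _] zx; rewrite zx dd; lra.
  case: (pselect (exists i z, d y z < d x y / 8%:R /\ F i z <> None)).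
    move=> [i [z [/closeP yz Fi]]]; exists i => w yw; apply: fF; first exact: near_x.
    move=> j Fj; move/closeP: yw => yw; case: (ltngtP j i) => // ji.
      by exfalso; have := far _ _ _ _ ji Fj Fi; lra.
    by exfalso; have := far _ _ _ _ ji Fi Fj; lra.
  (* No copy meets the ball: all the [F i] are [None] there, and any index serves. *)
  move=> nF; exists 0%N => w yw; apply: fF; first exact: near_x.
  by move=> i Fi; exfalso; apply: nF; exists i, w.
have f_below z : z <> x -> below true (Some t) (f z).
  move=> zx; case: (f_cases z zx) => [->//|[j Fj ->]].
  have [Fs _ Fb _] := FP j; have tk := child_desc (child_kid j pt).
  have [->|/Fb] := pselect (z = s j); first by rewrite Fs.
  by case: (F j z) => //= u; exact: desc_trans.
have s_lim (A : set X) : (forall J, exists2 j, (J <= j)%N & A (s j)) -> limit_point A x.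
  move=> sA; apply/limit_pointP => c /r_cvg[J rJ]; have [j Jj Aj] := sA J.
  by exists (s j); split => //; exact: rJ.
have f_at y : y <> x -> coloring_at f y.
  move=> /f_local[c c0 [j fj]]; apply: coloring_at_near c0 fj _.
  by have [_ _ _] := FP j.
exists f; split => //.
- move=> y fy; case: (pselect (y = x)) => [->|yx]; first by rewrite dd.
  case: (f_cases y yx) => // -[j /F_near[_ yj] _].
  by move: yj (r_le0 j); lra.
- move=> y; case: (pselect (y = x)) => [{y}->|]; last exact: f_at.
  split.
  + by exists 1 => // z _ zx; rewrite fx; exact: f_below.
  + move=> t' u; rewrite fx => -[<-] tu; apply: s_lim => J.
    by have [a Ja au] := kid_child J tu; exists a => //; rewrite /preimage /mkset fs au.
  (* Each [s j] is a limit of points coloured [None], hence so is [x]. *)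
  + apply: limit_point_limit_point; apply: s_lim => J; exists J => //.
    by case: (f_at _ (sx J)).
Qed.

Lemma metric_realizable (C : convergence_space -> Prop) k t :
  [set: X] !=set0 -> C (metric_space X) -> perfect k t -> realizable C t.
Proof.
move=> [x _] CX pt; have [f [fx _ _ f_at]] := tree_coloring x pt (@ltr01 R).
exists true, (metric_space X), f, x; split => //; apply: coloring_child.
- move=> A y yA; have [[e e0 ye] _ _] := f_at y.
  have [z [zy Az yz]] := (limit_pointP A y).1 yA e e0.
  by exists z => //; exact: ye.
- by move=> y u v fy uv; have [_ /(_ _ _ fy uv)] := f_at y.
- by move=> _ y; have [] := f_at y.
Qed.

End metric_realization.

Theorem theorem8p7 (R : realType) (C : convergence_space -> Prop)
  (hC : [\/ forall (W : finType) (r : rel W) (r_trans : transitive r),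
              irreflexive r -> C (kripke_space r_trans),
            forall (W : finType) (r : rel W) (r_trans : transitive r),
              serial r -> connected_frame r -> locally_connected_frame r ->
              C (kripke_space r_trans),
            forall Lambda : ordinal_ww, C (ordinal_space Lambda)
          | exists X : metricType R,
              [/\ [set: X] !=set0, crowded X & C (metric_space X)]]) :
  forall N : nat, exists theta : formula,
    [/\ in_Lmu theta, (N <= fsize theta)%N
      & forall psi : formula, in_Ltangle_forall psi ->
          equivalent C theta psi ->
          2%:R `^ ((fsize theta)%:R / 12%:R) < (fsize psi)%:R :> R].
Proof.
have real k t : perfect k t -> realizable C t.
  move=> pt; case: hC => [CGL|CTC|Cord|[X [X0 crowdedX CX]]].
  - exact: GL_realizable.
  - exact: TC_realizable.
  - exact: (ordinal_realizable pt Cord).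
  - exact: (metric_realizable crowdedX X0 CX pt).
move=> N; exists (theta N.+1); split; first exact: in_Lmu_theta.
  by rewrite fsize_theta; lia.
move=> psi Lpsi /(fsize_lower_bound real Lpsi).
rewrite -(ler_nat R) natrX; apply: lt_le_trans.
(* The exponent (12 (N + 1) + 1) / 12 is below N + 2. *)
rewrite -powR_mulrn// fsize_theta; rewrite /powR pnatr_eq0 /= ltr_expR.
rewrite ltr_pM2r ?ln_gt0 ?ltr1n//.
by rewrite ltr_pdivrMr// -natrM ltr_nat; lia.
Qed.
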